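(* Let $D=\langle S,s_0,A,\Pr,R\rangle$ be an NMRDP and let $\phi_0$ be a reward function specification representing $R$ (i.e. $R_{\phi_0}=R$). Assume that $\phi_0$ is reward-normal and that no e-state $\langle s,\phi\rangle$ built in the translation has $(\bot:r)\in\phi$ for some $r$. Let $D'=\langle S',s_0',A',\Pr',R'\rangle$ be the translation of $D$ obtained by progression of $\phi_0$ (defined in the context). Then $D'$ is a blind minimal equivalent XMDP for $D$.
   Context: **Sequences.** $S^*$ is the set of finite sequences of states over $S$, and $S^\omega$ the set of possibly infinite state sequences. $\Gamma_i$ is the state of index $i$ (from $0$) of $\Gamma$, $\Gamma(i)=\langle\Gamma_0,\dots,\Gamma_i\rangle\in S^*$ is a prefix of $\Gamma$ ($\Gamma(-1)$ is the empty sequence), $\mathrm{pre}(\Gamma)$ is the set of finite prefixes of $\Gamma$, and ''$;$'' is concatenation. **Decision processes.** An MDP is $\langle S,s_0,A,\Pr,R\rangle$ with $S$ a finite set of states, $s_0\in S$ the initial state, $A$ a finite set of actions ($A(s)\subseteq A$ being those applicable in $s$), a probability distribution $\Pr(s,a,\cdot)$ over $S$ for each $s\in S$, $a\in A(s)$, and a reward function $R:S\to\mathbb R$. An NMRDP (decision process with non-Markovian rewards) is identical except that the domain of $R$ is $S^*$. $\widetilde D(s)$ is the set of feasible sequences rooted at $s$: those $\Gamma\in S^\omega$ with $\Gamma_0=s$ such that for all $i$ (for which $\Gamma_{i+1}$ exists) there is $a\in A(\Gamma_i)$ with $\Pr(\Gamma_i,a,\Gamma_{i+1})>0$. Each state is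 a subset of a set $\mathcal P$ of basic propositions. **Equivalent XMDP.** An MDP $D'=\langle S',s_0',A',\Pr',R'\rangle$ is an equivalent XMDP for the NMRDP $D$ if there is $\tau:S'\to S$ such that: (1) $\tau(s_0')=s_0$; (2) for all $s'\in S'$, $A'(s')=A(\tau(s'))$; (3) for all $s_1,s_2\in S$, if there is $a\in A(s_1)$ with $\Pr(s_1,a,s_2)>0$, then for all $s_1'\in S'$ with $\tau(s_1')=s_1$ there is a unique $s_2'\in S'$, $\tau(s_2')=s_2$, such that for all $a\in A'(s_1')$, $\Pr'(s_1',a,s_2')=\Pr(s_1,a,s_2)$; (4) for any $\Gamma\in\widetilde D(s_0)$ and $\Gamma'\in\widetilde{D'}(s_0')$ with $\tau(\Gamma'_i)=\Gamma_i$ for all $i$, $R'(\Gamma'_i)=R(\Gamma(i))$ for all $i$. Elements of $S'$ are called e-states. **Blind minimality.** To simplify notation, each e-state of an equivalent XMDP is represented as a pair $\langle s,r\rangle$, where $s\in S$ is the state labeling it and $r:S^*\to\mathbb R$ is a function intuitively assigning rewards to sequences in the NMRDP starting from $s$ (a given $s$ may be paired with several $r$, corresponding to relevantly different histories of $s$). An equivalent XMDP $D'$ for $D$, with set of e-states $S'$, is blind minimal iff for each e-state $\langle s,r\rangle\in S'$ there exists a prefix $\Gamma(i)\in\widetilde D(s_0)$ such that $\Gamma_i=s$ and for all $\Delta\in S^*$: $r(\Delta)=R(\Gamma(i-1);\Delta)$ if $\Delta_0=s$, and $r(\Delta)=0$ otherwise. **\$FLTL.** Formulae are built from literals $p$,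 $\neg p$ ($p\in\mathcal P$), $\top$, $\bot$, $\$$ (a special propositional constant) by $\wedge,\vee,\bigcirc$ (next), $\mathsf U$ (weak until). For $B\subseteq S^*$ and $\Gamma\in S^\omega$: $(\Gamma,i)\models_B\$$ iff $\Gamma(i)\in B$; $(\Gamma,i)\models_B\top$; $(\Gamma,i)\not\models_B\bot$; $(\Gamma,i)\models_B p$ iff $p\in\Gamma_i$; $(\Gamma,i)\models_B\neg p$ iff $p\notin\Gamma_i$; $\wedge,\vee$ are interpreted classically; $(\Gamma,i)\models_B\bigcirc f$ iff $(\Gamma,i+1)\models_B f$; $(\Gamma,i)\models_B f_1\,\mathsf U\,f_2$ iff for all $k\ge i$, if $(\Gamma,j)\not\models_B f_2$ for all $j$ with $i\le j\le k$, then $(\Gamma,k)\models_B f_1$. $\Gamma\models_B f$ means $(\Gamma,0)\models_B f$, and $\models_B f$ means $\Gamma\models_B f$ for all $\Gamma\in S^\omega$. $B_f=\bigcap\{B\mid\ \models_B f\}$ (with $\bigcap\emptyset=S^*$). $f$ is reward-normal iff for every $\Gamma\in S^\omega$ and every $B\subseteq S^*$: $\Gamma\models_B f$ iff $B_f\cap\mathrm{pre}(\Gamma)\subseteq B$. **Progression.** For a boolean $b$, a state $s$ and a formula: $\mathrm{Prog}(\text{true},s,\$)=\top$; $\mathrm{Prog}(\text{false},s,\$)=\bot$; $\mathrm{Prog}(b,s,\top)=\top$; $\mathrm{Prog}(b,s,\bot)=\bot$; $\mathrm{Prog}(b,s,p)=\top$ if $p\in s$ and $\bot$ otherwise; $\mathrm{Prog}(b,s,\neg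 p)=\top$ if $p\notin s$ and $\bot$ otherwise; $\mathrm{Prog}(b,s,f_1\wedge f_2)=\mathrm{Prog}(b,s,f_1)\wedge\mathrm{Prog}(b,s,f_2)$; $\mathrm{Prog}(b,s,f_1\vee f_2)=\mathrm{Prog}(b,s,f_1)\vee\mathrm{Prog}(b,s,f_2)$; $\mathrm{Prog}(b,s,\bigcirc f)=f$; $\mathrm{Prog}(b,s,f_1\,\mathsf U\,f_2)=\mathrm{Prog}(b,s,f_2)\vee(\mathrm{Prog}(b,s,f_1)\wedge (f_1\,\mathsf U\,f_2))$. Results are simplified by the usual laws for $\top$ and $\bot$ in conjunctions and disjunctions. $\mathrm{Rew}(s,f)$ is true iff $\mathrm{Prog}(\text{false},s,f)=\bot$, and $\$\mathrm{Prog}(s,f)=\mathrm{Prog}(\mathrm{Rew}(s,f),s,f)$. **Reward function specifications.** A reward function specification is a set $\phi$ of pairs $(f:r)$ with $f$ a \$FLTL formula and $r\in\mathbb R$; it is reward-normal if all formulae in it are. It represents the reward function $R_\phi(\Gamma(i))=\sum_{(f:r)\in\phi}\{r\mid\Gamma(i)\in B_f\}$, i.e. the sum of the $r$ for those $(f:r)\in\phi$ with $\Gamma(i)\in B_f$. $\mathrm{SProg}(s,\phi)=\{(\$\mathrm{Prog}(s,f):r)\mid(f:r)\in\phi\}$. **The translation.** (1) $S'\subseteq S\times 2^{\$FLTL\times\mathbb R}$ (the e-states are generated from $s_0'$ by the successor rule in (4)); (2) $s_0'=\langle s_0,\phi_0\rangle$; (3) $A'(\langle s,\phi\rangle)=A(s)$;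 (4) if $a\in A'(\langle s,\phi\rangle)$, then $\Pr'(\langle s,\phi\rangle,a,\langle s',\phi'\rangle)=\Pr(s,a,s')$ if $\phi'=\mathrm{SProg}(s,\phi)$ and $0$ otherwise, so the successors of $\langle s,\phi\rangle$ via $a$ are the $\langle s',\mathrm{SProg}(s,\phi)\rangle$ with $\Pr(s,a,s')>0$; if $a\notin A'(\langle s,\phi\rangle)$, $\Pr'(\langle s,\phi\rangle,a,\cdot)$ is undefined; (5) $R'(\langle s,\phi\rangle)=\sum_{(f:r)\in\phi}\{r\mid\mathrm{Rew}(s,f)\}$. Two e-states $\langle s,\phi\rangle$ and $\langle t,\psi\rangle$ are equal if $s=t$, the immediate rewards are the same, and the results of progressing $\phi$ and $\psi$ through $s$ are semantically equivalent.
   Formalization: Added: every state reachable from s0 has an applicable action (else false: A(s0)=∅, φ0={($∨○(p∧¬p):r)}, r≠0). Specifications are finite multisets of pairs, since as sets, distinct pairs may progress to one and lose a reward; ''semantically equivalent'' means equal reward functions. *)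

(* Defs.v *)
From HB Require Import structures.
From mathcomp Require Import all_boot all_order all_algebra.
From mathcomp Require Import boolp classical_sets functions cardinality fsbigop.
From mathcomp Require Import reals.

Set Implicit Arguments.
Unset Strict Implicit.
Unset Printing Implicit Defensive.

Import Order.TTheory GRing.Theory Num.Theory.

Local Open Scope classical_set_scope.
Local Open Scope ring_scope.

Inductive pseq (S : Type) : Type :=
| FinSeq of seq S
| InfSeq of (nat -> S).

Section Sequences.
Variable S : Type.

Definition state_at (G : pseq S) (i : nat) : option S :=
  match G with FinSeq t => onth t i | InfSeq g => Some (g i) end.

(* The first [n] states of [G]: the prefix written Gamma(i) is [first G i.+1],
   and [first G 0] is Gamma(-1). *)
Definition first (G : pseq S) (n : nat) : seq S :=
  match G with FinSeq t => take n t | InfSeq g => mkseq g n end.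

End Sequences.

(* [prob s a] is meaningful only when [a \in appl s]; it is a junk value
   otherwise, and no definition below constrains or uses it in that case. *)
Record process (R : realType) (S : Type) (A : finType) := Process {
  start : S;
  appl : S -> {set A};
  prob : S -> A -> S -> R }.

Record mdp (R : realType) (S : Type) (A : finType) := Mdp {
  mdp_process :> process R S A;
  mdp_reward : S -> R }.

Record nmrdp (R : realType) (S : Type) (A : finType) := Nmrdp {
  nmrdp_process :> process R S A;
  nmrdp_reward : seq S -> R }.

Section Processes.
Variables (R : realType) (A : finType).

Definition stochastic (S : choiceType) (D : process R S A) : Prop :=
  forall s a, a \in appl D s ->
    (forall t, 0 <= prob D s a t) /\ \sum_(t \in [set: S]) prob D s a t = 1.

Definition finite_process (S : choiceType) (D : process R S A) : Prop :=
  finite_set [set: S] /\ stochastic D.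

Definition feasible (S : Type) (D : process R S A) (s : S) (G : pseq S) : Prop :=
  state_at G 0 = Some s /\
  forall i x y, state_at G i = Some x -> state_at G i.+1 = Some y ->
    exists2 a, a \in appl D x & 0 < prob D x a y.

(* Standing convention for decision processes whose policies pick an applicable
   action in every state; it is only required of the reachable states. *)
Definition no_dead_end (S : Type) (D : process R S A) : Prop :=
  forall G i s, feasible D (start D) G -> state_at G i = Some s ->
    exists a, a \in appl D s.

Section Expansion.
Variables (S S' : choiceType) (D : nmrdp R S A) (D' : mdp R S' A).
Variable tau : S' -> S.

Record equivalent_xmdp : Prop := EquivalentXmdp {
  xmdp_mdp : finite_process D';
  xmdp_start : tau (start D') = start D;
  xmdp_appl : forall s', appl D' s' = appl D (tau s');
  xmdp_succ : forall s1 s2,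
    (exists2 a, a \in appl D s1 & 0 < prob D s1 a s2) ->
    forall s1', tau s1' = s1 ->
    exists! s2', tau s2' = s2 /\
      forall a, a \in appl D' s1' -> prob D' s1' a s2' = prob D s1 a s2;
  xmdp_reward : forall G G',
    feasible D (start D) G -> feasible D' (start D') G' ->
    (forall i, omap tau (state_at G' i) = state_at G i) ->
    forall i s', state_at G' i = Some s' ->
      mdp_reward D' s' = nmrdp_reward D (first G i.+1) }.

(* The e-state [e] is represented by the pair [(tau e, r e)].  Injectivity says
   that the set of e-states is a set of such pairs; the second clause says that
   [r e] assigns to the sequences that can be followed from [e] the rewards they
   receive in [D']. *)
Definition represents (r : S' -> seq S -> R) : Prop :=
  injective (fun e => (tau e, r e)) /\
  forall e G', feasible D' e G' -> forall i e', state_at G' i = Some e' ->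
    mdp_reward D' e' = r e (map tau (first G' i.+1)).

Definition blind_minimal : Prop :=
  exists2 r : S' -> seq S -> R, represents r &
    forall e, exists G i,
      [/\ feasible D (start D) G, state_at G i = Some (tau e) &
          forall Delta, r e Delta =
            if ohead Delta == Some (tau e)
            then nmrdp_reward D (first G i ++ Delta) else 0].

End Expansion.

Definition blind_minimal_equivalent_xmdp (S S' : choiceType)
    (D : nmrdp R S A) (D' : mdp R S' A) : Prop :=
  exists2 tau : S' -> S, equivalent_xmdp D D' tau & blind_minimal D D' tau.

End Processes.

Inductive fltl (P : Type) : Type :=
| Lit of P
| NLit of P
| Top
| Bot
| Dollar
| And of fltl P & fltl P
| Or of fltl P & fltl P
| Next of fltl P
| Until of fltl P & fltl P.

Arguments Top {P}.
Arguments Bot {P}.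
Arguments Dollar {P}.

HB.instance Definition _ (P : Type) := gen_eqMixin (fltl P).
HB.instance Definition _ (P : Type) := gen_choiceMixin (fltl P).

Section Logic.
Variables (P : Type) (S : choiceType).
(* A state is identified with the set [lab s] of the propositions it contains. *)
Variable lab : S -> pred P.

(* The clauses inspect every index of the sequence, so formulae are interpreted
   over infinite sequences. *)
Fixpoint sat (B : set (seq S)) (G : nat -> S) (i : nat) (f : fltl P) : Prop :=
  match f with
  | Lit p => lab (G i) p
  | NLit p => ~~ lab (G i) p
  | Top => True
  | Bot => False
  | Dollar => B (mkseq G i.+1)
  | And f1 f2 => sat B G i f1 /\ sat B G i f2
  | Or f1 f2 => sat B G i f1 \/ sat B G i f2
  | Next f1 => sat B G i.+1 f1
  | Until f1 f2 => forall k, (i <= k)%N ->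
      (forall j, (i <= j <= k)%N -> ~ sat B G j f2) -> sat B G k f1
  end.

Definition valid (B : set (seq S)) (f : fltl P) : Prop :=
  forall G, sat B G 0 f.

Definition behaviour (f : fltl P) : set (seq S) :=
  \bigcap_(B in [set B | valid B f]) B.

Definition pre (G : nat -> S) : set (seq S) := range (mkseq G).

Definition reward_normal (f : fltl P) : Prop :=
  forall G B, sat B G 0 f <-> behaviour f `&` pre G `<=` B.

Fixpoint progress (b : bool) (s : S) (f : fltl P) : fltl P :=
  match f with
  | Dollar => if b then Top else Bot
  | Top => Top
  | Bot => Bot
  | Lit p => if lab s p then Top else Bot
  | NLit p => if lab s p then Bot else Top
  | And f1 f2 => And (progress b s f1) (progress b s f2)
  | Or f1 f2 => Or (progress b s f1) (progress b s f2)
  | Next f1 => f1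
  | Until f1 f2 => Or (progress b s f2) (And (progress b s f1) (Until f1 f2))
  end.

Definition simp_and (f g : fltl P) : fltl P :=
  match f, g with
  | Bot, _ | _, Bot => Bot
  | Top, h | h, Top => h
  | _, _ => And f g
  end.

Definition simp_or (f g : fltl P) : fltl P :=
  match f, g with
  | Top, _ | _, Top => Top
  | Bot, h | h, Bot => h
  | _, _ => Or f g
  end.

Fixpoint simp (f : fltl P) : fltl P :=
  match f with
  | And f1 f2 => simp_and (simp f1) (simp f2)
  | Or f1 f2 => simp_or (simp f1) (simp f2)
  | Next f1 => Next (simp f1)
  | Until f1 f2 => Until (simp f1) (simp f2)
  | _ => f
  end.

Definition prog (b : bool) (s : S) (f : fltl P) : fltl P := simp (progress b s f).

Definition rew (s : S) (f : fltl P) : bool := prog false s f == Bot.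

Definition dprog (s : S) (f : fltl P) : fltl P := prog (rew s f) s f.

End Logic.

(* A specification is a finite multiset of pairs (f : r), represented as a list
   whose order is irrelevant.  Multiplicities matter: two distinct formulae with
   the same reward may progress to the same formula, and both rewards must still
   be counted afterwards. *)
Definition spec (R : realType) (P : Type) : Type := seq (fltl P * R).

Section Specifications.
Variables (R : realType) (P : Type) (S : choiceType) (lab : S -> pred P).

Definition spec_reward (phi : spec R P) (Delta : seq S) : R :=
  \sum_(fr <- phi | Delta \in behaviour lab fr.1) fr.2.

(* Rewards are attached to the prefixes Gamma(i) with [i >= 0], hence to nonempty
   sequences only. *)
Definition spec_represents (phi : spec R P) (rwd : seq S -> R) : Prop :=
  forall Delta, Delta <> [::] -> spec_reward phi Delta = rwd Delta.

Definition spec_reward_normal (phi : spec R P) : Prop :=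
  forall fr, fr \in phi -> reward_normal lab fr.1.

(* Rewards are additive, so semantic equivalence of specifications is equality of
   the reward functions they represent, not a correspondence between formulae. *)
Definition spec_equiv (phi psi : spec R P) : Prop :=
  forall Delta : seq S, Delta <> [::] -> spec_reward phi Delta = spec_reward psi Delta.

Definition sprog (s : S) (phi : spec R P) : spec R P :=
  [seq (dprog lab s fr.1, fr.2) | fr <- phi].

Definition immediate_reward (s : S) (phi : spec R P) : R :=
  \sum_(fr <- phi | rew lab s fr.1) fr.2.

End Specifications.

Section Translation.
Variables (R : realType) (A : finType) (P : Type) (S : choiceType).
Variables (lab : S -> pred P) (D : process R S A) (phi0 : spec R P).

Inductive built : S -> spec R P -> Prop :=
| built_start : built (start D) phi0
| built_succ s phi a s' : built s phi ->
    a \in appl D s -> 0 < prob D s a s' -> built s' (sprog lab s phi).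

Definition estate_eq (e1 e2 : S * spec R P) : Prop :=
  [/\ e1.1 = e2.1,
      immediate_reward lab e1.1 e1.2 = immediate_reward lab e2.1 e2.2 &
      spec_equiv lab (sprog lab e1.1 e1.2) (sprog lab e2.1 e2.2)].

Definition eclass (e : S * spec R P) : set (S * spec R P) :=
  [set e' | built e'.1 e'.2 /\ estate_eq e e'].

(* The e-states of the translation are the generated pairs up to [estate_eq]. *)
Definition estates : set (set (S * spec R P)) :=
  [set C | exists2 e, built e.1 e.2 & C = eclass e].

Definition estate : choiceType := {C : set (S * spec R P) | C \in estates}.

Lemma start_class_in : eclass (start D, phi0) \in estates.
Proof.
by rewrite inE; exists (start D, phi0) => //; exact: built_start.
Qed.

Definition start_estate : estate := exist _ (eclass (start D, phi0)) start_class_in.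

Definition erepr (C : estate) : S * spec R P := xget (start D, phi0) (val C).

(* All the members of an e-state share their state and their immediate reward, so
   reading these off a representative involves no choice.  The transition clause
   is stated without representatives. *)
Definition translation : mdp R estate A :=
  Mdp (Process start_estate
         (fun C => appl D (erepr C).1)
         (fun C a C' =>
            let s := (erepr C).1 in let s' := (erepr C').1 in
            if `[< exists2 phi, val C (s, phi) & val C' (s', sprog lab s phi) >]
            then prob D s a s' else 0))
      (fun C => immediate_reward lab (erepr C).1 (erepr C).2).

Definition no_bot_built : Prop :=
  forall s phi, built s phi -> forall r, (Bot, r) \notin phi.

End Translation.

(* Main.v *)
(* For a reward-normal [f], [Rew s f] decides semantically whether [s] lies in
   the behaviour of [f], and $-progression through [s] represents the derivative
   of that behaviour by [s].  Soundness is immediate; completeness could fail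
   because [Rew] tests for the formula [Bot] itself.  It holds since all temporal
   operators are safety operators: an unsatisfied formula progresses to [Bot]
   after finitely many states, which the absence of [Bot] along an infinite
   feasible path from [s] rules out.  Hence an e-state amounts to a state together
   with the derivative of the reward function by the history that led to it, and
   this is blind minimality.  There are finitely many e-states because progressed
   formulae are boolean functions of the subformulae of the initial ones. *)
Require Import Defs.
From HB Require Import structures.
From mathcomp Require Import all_boot all_order all_algebra.
From mathcomp Require Import boolp classical_sets functions cardinality fsbigop.
From mathcomp Require Import reals.

Set Implicit Arguments.
Unset Strict Implicit.
Unset Printing Implicit Defensive.

Import Order.TTheory GRing.Theory Num.Theory.

Local Open Scope classical_set_scope.
Local Open Scope ring_scope.

(** * Prefixes of finite and infinite sequences *)

Section Prefixes.

Variable T : Type.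
Implicit Type G : pseq T.

Lemma state_at_first G i x :
  state_at G i = Some x -> first G i.+1 = rcons (first G i) x.
Proof.
case: G => [t|g]; last first.
  by case=> <-; rewrite /first -addn1 /mkseq iotaD map_cat cats1.
move=> tx.
have it : (i < size t)%N by rewrite -onthTE [onth _ _]tx.
by rewrite /first (take_nth x) // (onth_nth x x t i tx).
Qed.

Lemma state_at_prev G i y :
  state_at G i.+1 = Some y -> exists x, state_at G i = Some x.
Proof.
case: G => [t|g] ty; last by exists (g i).
have : (i.+1 < size t)%N by rewrite -onthTE [onth _ _]ty.
by move=> /ltnW; rewrite -onthTE /=; case: onth => // x _; exists x.
Qed.

Lemma first_end G i : state_at G i = None -> first G i.+1 = first G i.
Proof.
case: G => [t|//] tN; have : (size t <= i)%N by rewrite -onthNE [onth _ _]tN.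
by move=> ti; rewrite /first !take_oversize // ltnW.
Qed.

Lemma first0 G : first G 0 = [::].
Proof. by case: G => //= t; rewrite take0. Qed.

Lemma ohead_first G i : ohead (first G i.+1) = state_at G 0.
Proof. by case: G => [[|x t]|g]. Qed.

End Prefixes.

Lemma map_first (T U : Type) (f : T -> U) (G : pseq U) (G' : pseq T) i :
  (forall j, omap f (state_at G' j) = state_at G j) ->
  map f (first G' i) = first G i.
Proof.
move=> GG'; elim: i => [|i IHi]; first by rewrite !first0.
move: (GG' i); case E: (state_at G' i) => [x|] /= /esym Gi.
  by rewrite (state_at_first E) (state_at_first Gi) map_rcons IHi.
by rewrite (first_end E) (first_end Gi).
Qed.

(** * Simplification, progression and the behaviour of a progressed formula *)

Section Progression.
Variables (P : Type) (S : choiceType) (lab : S -> pred P).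
Implicit Types (B : set (seq S)) (G : nat -> S) (f g : fltl P).

Lemma simp_andr_Bot f : simp_and f Bot = Bot. Proof. by case: f. Qed.
Lemma simp_andr_Top f : simp_and f Top = f. Proof. by case: f. Qed.
Lemma simp_and_Top f : simp_and Top f = f. Proof. by case: f. Qed.
Lemma simp_orr_Bot f : simp_or f Bot = f. Proof. by case: f. Qed.
Lemma simp_orr_Top f : simp_or f Top = Top. Proof. by case: f. Qed.
Lemma simp_or_Bot f : simp_or Bot f = f. Proof. by case: f. Qed.

Definition simpE :=
  (simp_andr_Bot, simp_andr_Top, simp_and_Top,
   simp_orr_Bot, simp_orr_Top, simp_or_Bot).

Lemma sat_simp B G i f : sat lab B G i (simp f) <-> sat lab B G i f.
Proof.
have satA j g h : sat lab B G j (simp_and g h) <-> sat lab B G j (And g h).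
  by case: g; case: h => * /=; tauto.
have satO j g h : sat lab B G j (simp_or g h) <-> sat lab B G j (Or g h).
  by case: g; case: h => * /=; tauto.
elim: f i => //= [f IHf g IHg|f IHf g IHg|f IHf g IHg] i.
- by rewrite satA /= IHf IHg.
- by rewrite satO /= IHf IHg.
- by split=> U k ik nU; apply/IHf/U => // j /nU njg /IHg.
Qed.

(** The fixpoint unfolding of weak until, which the [Until] clause of [progress] imitates. *)
Lemma sat_until B G i f g :
  sat lab B G i (Until f g) <->
  sat lab B G i g \/ sat lab B G i f /\ sat lab B G i.+1 (Until f g).
Proof.
split=> [U|[gi k ik /(_ i)|[fi U] k]].
- have [gi|ngi] := pselect (sat lab B G i g); [by left|right; split].
    by apply: U => // j; rewrite -eqn_leq => /eqP <-.
  move=> k ik nU; apply: U => [|j /andP[]]; first exact: ltnW.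
  by rewrite leq_eqVlt => /predU1P[<- //|ij jk]; apply: nU; rewrite ij.
- by rewrite leqnn ik => /(_ isT).
- rewrite leq_eqVlt => /predU1P[<- //|ik nU]; apply: U => // j /andP[ij jk].
  by apply: nU; rewrite jk ltnW.
Qed.

(** The boolean has to agree with [B] on the prefix ending at index [i], because this is what
    [Dollar] reads there. *)
Lemma sat_progress (b : bool) B G i f : (b <-> B (mkseq G i.+1)) ->
  sat lab B G i.+1 (progress lab b (G i) f) <-> sat lab B G i f.
Proof.
move=> bB; elim: f => //=.
- by move=> p; case: (lab (G i) p).
- by move=> p; case: (lab (G i) p).
- by apply: iff_trans bB; case: (b).
- by move=> f IHf g IHg; rewrite IHf IHg.
- by move=> f IHf g IHg; rewrite IHf IHg.
- by move=> f IHf g IHg; rewrite IHf IHg; apply: iff_sym; apply: sat_until.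
Qed.

Lemma sat_ext B B' G i f :
  (forall n, B (mkseq G n.+1) <-> B' (mkseq G n.+1)) ->
  sat lab B G i f <-> sat lab B' G i f.
Proof.
move=> BB'; elim: f i => //= [f IHf g IHg i|f IHf g IHg i|f IHf g IHg i].
- by rewrite IHf IHg.
- by rewrite IHf IHg.
- by split=> U k ik nU; apply/IHf/U => // j /nU njg /IHg.
Qed.

Definition scons (s : S) G (n : nat) : S := if n is m.+1 then G m else s.

Lemma mkseq_scons s G n : mkseq (scons s G) n.+1 = s :: mkseq G n.
Proof. by rewrite /mkseq /= -[1%N]addn0 iotaDl -map_comp. Qed.

Lemma sat_scons B s G i f :
  sat lab B (scons s G) i.+1 f <-> sat lab [set D | B (s :: D)] G i f.
Proof.
elim: f i => //= [i|f IHf g IHg i|f IHf g IHg i|f IHf g IHg i].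
- by rewrite mkseq_scons.
- by rewrite IHf IHg.
- by rewrite IHf IHg.
- split=> U k ik nU.
    apply/IHf/U => // -[//|j] /nU njg /IHg; exact: njg.
  case: k => // k in ik nU *; apply/IHf/U => // j ijk /IHg.
  exact: (nU j.+1).
Qed.

(** Undoes one progression: the set on the right settles [[:: s]] by [b] and every longer prefix by
    its tail. *)
Lemma sat_prog_scons (b : bool) B s G f :
  sat lab B G 0 (prog lab b s f) <->
  sat lab [set D | if behead D is [::] then b : Prop else B (behead D)]
    (scons s G) 0 f.
Proof.
set B' := (X in _ <-> sat _ X _ _ _).
rewrite sat_simp -(@sat_progress b B')//.
apply: iff_trans (iff_sym (sat_scons _ _ _ _ _)).
by apply: sat_ext => n.
Qed.

Lemma behaviour_eq (x0 : S) f (C : set (seq S)) :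
  (forall G B, sat lab B G 0 f <-> C `&` pre G `<=` B) -> behaviour lab f = C.
Proof.
move=> fC; apply/seteqP; split=> [D|D CD B vB].
  by apply=> G; apply/fC => E [].
(* The function [nth x0 D] is an infinite sequence having [D] as a prefix; this is the only use of
   [x0]. *)
apply: (fC _ _).1 (vB (nth x0 D)) _ _; split=> //.
by exists (size D) => //; rewrite mkseq_nth.
Qed.

(** [Dollar] only reads nonempty prefixes, so removing [[::]] from the full set does not affect
    satisfaction. *)
Lemma normal_behaviour_nil f : reward_normal lab f -> ~ behaviour lab f [::].
Proof.
move=> fN /(_ [set~ [::]]); apply=> //= G.
by apply: (sat_ext (B := setT) _ _ _).1; last by apply/fN.
Qed.

(** The right boolean discharges the prefix [[:: s]] and leaves the demands on longer prefixes, so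
    the new behaviour is the derivative by [s]. The empty sequence is excluded from [C], since no
    reward-normal formula has it in its behaviour. *)
Lemma prog_normal f s (b : bool) :
  reward_normal lab f -> (b <-> behaviour lab f [:: s]) ->
  reward_normal lab (prog lab b s f) /\
  forall D, D <> [::] ->
    behaviour lab (prog lab b s f) D <-> behaviour lab f (s :: D).
Proof.
move=> fN bf; pose C := [set D | D <> [::] /\ behaviour lab f (s :: D)].
have fC G B : sat lab B G 0 (prog lab b s f) <-> C `&` pre G `<=` B.
  rewrite sat_prog_scons fN; split=> sub D.
    move=> [[D0 fD] [n _ DE]]; have /= := sub (s :: D); case: D DE D0 fD => //.
    move=> x D DE _ fD; apply; split=> //; exists n.+1 => //.
    by rewrite mkseq_scons DE.
  move=> [fD [n _ DE]]; case: n DE => [DE|n].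
    by case: (normal_behaviour_nil fN); rewrite -DE in fD *.
  rewrite mkseq_scons => DE; rewrite -DE in fD *.
  case: n {DE} fD => [/bf //|n] fD /=; apply: sub.
  by split; [split|exists n.+1].
have CE := behaviour_eq s fC.
split=> [G B|D D0]; first by rewrite CE fC.
by rewrite CE /C /=; tauto.
Qed.

(** * Commutation of simplification with progression *)

Lemma simp_simp_and f g : simp (simp_and f g) = simp_and (simp f) (simp g).
Proof.
case: f => *; case: g => *; by rewrite ?simpE /= ?simpE.
Qed.

Lemma simp_simp_or f g : simp (simp_or f g) = simp_or (simp f) (simp g).
Proof.
case: f => *; case: g => *; by rewrite ?simpE /= ?simpE.
Qed.

Lemma simp_idem f : simp (simp f) = simp f.
Proof.
elim: f => //= [f IHf g IHg|f IHf g IHg|f -> //|f -> g -> //].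
- by rewrite simp_simp_and IHf IHg.
- by rewrite simp_simp_or IHf IHg.
Qed.

Lemma prog_simp_and b s f g :
  prog lab b s (simp_and f g) = simp_and (prog lab b s f) (prog lab b s g).
Proof.
rewrite /prog; case: f => *; case: g => *; by rewrite ?simpE /= ?simpE.
Qed.

Lemma prog_simp_or b s f g :
  prog lab b s (simp_or f g) = simp_or (prog lab b s f) (prog lab b s g).
Proof.
rewrite /prog; case: f => *; case: g => *; by rewrite ?simpE /= ?simpE.
Qed.

(** The equality is syntactic, because [rew] and [falsified] compare with the formula [Bot] itself.
    It absorbs the simplifications that [simp] makes below temporal operators. *)
Lemma prog_simp b s f : prog lab b s (simp f) = prog lab b s f.
Proof.
elim: f => //= [f IHf g IHg|f IHf g IHg|f _|f IHf g IHg].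
- by rewrite prog_simp_and IHf IHg.
- by rewrite prog_simp_or IHf IHg.
- exact: simp_idem.
- by move: IHf IHg; rewrite /prog /= => -> ->; rewrite !simp_idem.
Qed.

(** * Violations are detected after finitely many progressions *)

Section Safety.
Variables (G : nat -> S) (b : nat -> bool).

Fixpoint progn i n f : fltl P :=
  if n is m.+1 then progn i.+1 m (prog lab (b i) (G i) f) else f.

Lemma progn_and i n f g :
  progn i n (simp_and f g) = simp_and (progn i n f) (progn i n g).
Proof. by elim: n i f g => //= n IHn i f g; rewrite prog_simp_and IHn. Qed.

Lemma progn_or i n f g :
  progn i n (simp_or f g) = simp_or (progn i n f) (progn i n g).
Proof. by elim: n i f g => //= n IHn i f g; rewrite prog_simp_or IHn. Qed.

Lemma progn_simp i n f : (0 < n)%N -> progn i n (simp f) = progn i n f.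
Proof. by case: n => //= n _; rewrite prog_simp. Qed.

Lemma progn_Bot i n : progn i n Bot = Bot.
Proof. by elim: n i => //=. Qed.

(** Asking for all large [n] lets the bounds for two formulae be combined by a maximum. *)
Definition falsified i f := exists N, forall n, (N <= n)%N -> progn i n f = Bot.

Lemma falsified_prog i f :
  falsified i.+1 (prog lab (b i) (G i) f) -> falsified i f.
Proof. by move=> [N fN]; exists N.+1 => -[//|n] /fN. Qed.

Lemma prog_falsified i f :
  falsified i f -> falsified i.+1 (prog lab (b i) (G i) f).
Proof. by move=> [N fN]; exists N => n Nn; apply: (fN n.+1); apply: leqW. Qed.

Lemma falsified_Bot i : falsified i Bot.
Proof. by exists 0%N => n _; apply: progn_Bot. Qed.

Lemma falsified_simp i f : falsified i f -> falsified i (simp f).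
Proof.
move=> [N fN]; exists N.+1 => n Nn; rewrite progn_simp ?(leq_trans _ Nn) //.
by apply: fN; apply: ltnW.
Qed.

Lemma falsified_andl i f g : falsified i f -> falsified i (simp_and f g).
Proof. by move=> [N fN]; exists N => n /fN; rewrite progn_and => ->. Qed.

Lemma falsified_andr i f g : falsified i g -> falsified i (simp_and f g).
Proof.
by move=> [N gN]; exists N => n /gN; rewrite progn_and => ->; rewrite simpE.
Qed.

Lemma falsified_or i f g :
  falsified i f -> falsified i g -> falsified i (simp_or f g).
Proof.
move=> [N fN] [M gM]; exists (maxn N M) => n.
by rewrite geq_max => /andP[/fN fn /gM gn]; rewrite progn_or fn gn.
Qed.

(* All temporal operators are safety operators: a violation is witnessed by a
   finite prefix, which progression detects syntactically. *)
Lemma unsat_falsified B i f : (forall n, b n <-> B (mkseq G n.+1)) ->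
  ~ sat lab B G i f -> falsified i f.
Proof.
move=> bB; elim: f i => [p|p||||f IHf g IHg|f IHf g IHg|f IHf|f IHf g IHg] i /= nsat.
- apply: falsified_prog; rewrite /prog /= (negbTE (introN idP nsat)).
  exact: falsified_Bot.
- apply: falsified_prog; rewrite /prog /=; case: (lab _ p) nsat => // _.
  exact: falsified_Bot.
- by case: nsat.
- exact: falsified_Bot.
- apply: falsified_prog; rewrite /prog /=.
  by case: (b i) (bB i) => [[/(_ isT)/nsat]|_] //; exact: falsified_Bot.
- apply: falsified_prog; have [fi|/IHf/prog_falsified] := pselect (sat lab B G i f).
    apply: falsified_andr; apply: (@prog_falsified i g).
    by apply: IHg => gi; apply: nsat.
  exact: falsified_andl.
- apply: falsified_prog; apply: falsified_or.
    by apply: (@prog_falsified i f); apply: IHf => fi; apply: nsat; left.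
  by apply: (@prog_falsified i g); apply: IHg => gi; apply: nsat; right.
- by apply: falsified_prog; apply: falsified_simp; apply: IHf.
(* A failed weak until provides an index [k] where [f] fails, [g] having failed from [i] up to
   [k]. *)
- move/existsNP: nsat => [k /not_implyP[ik /not_implyP[nU nf]]].
  have {}nU j : (i <= j <= k)%N -> falsified j g by move=> /nU /IHg.
  have step j : falsified j g -> falsified j f \/ falsified j.+1 (Until f g) ->
      falsified j (Until f g).
    move=> gj fU; apply: falsified_prog; apply: falsified_or.
      exact: (@prog_falsified j g).
    case: fU => [fj|Uj]; first exact/falsified_andl/(@prog_falsified j f).
    by apply: falsified_andr; apply: (@falsified_simp _ (Until f g)).
  have [m kE] : exists m, k = (i + m)%N by exists (k - i)%N; rewrite subnKC.
  (* Induction on the distance to [k]: at [k] the unfolded until dies through [f], and before [k]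
     through the until at the next index. *)
  elim: m i kE ik nU => [|m IHm] j kE jk nU.
    by rewrite addn0 in kE; rewrite -{j jk}kE in nU *; apply: step;
      [apply: nU; rewrite leqnn|left; apply: IHf].
  apply: step; first by apply: nU; rewrite leqnn.
  right; apply: IHm => [||l /andP[jl lk]]; rewrite ?addSnnS //.
    by rewrite kE addnS ltnS leq_addr.
  by apply: nU; rewrite lk ltnW.
Qed.

End Safety.

End Progression.

(** * Finitely many progressed formulae up to equivalence *)

Section Finiteness.
Variables (P : Type) (S : choiceType) (lab : S -> pred P).
Implicit Types (f g : fltl P) (L : seq (fltl P)).

Fixpoint subformulas f : seq (fltl P) :=
  f :: match f with
       | And f1 f2 | Or f1 f2 | Until f1 f2 => subformulas f1 ++ subformulas f2
       | Next f1 => subformulas f1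
       | _ => [::]
       end.

Lemma mem_subformulas f : f \in subformulas f.
Proof. by case: f => *; apply: mem_head. Qed.

Lemma subformulas_trans f g :
  f \in subformulas g -> {subset subformulas f <= subformulas g}.
Proof.
elim: g => [p|p||||g IHg h IHh|g IHg h IHh|g IHg|g IHg h IHh];
  rewrite in_cons => /predU1P[-> //|];
  rewrite // ?mem_cat => fg k kf; rewrite in_cons ?mem_cat;
  by [rewrite (IHg fg) ?orbT|case/orP: fg => [/IHg|/IHh] /(_ _ kf) ->; rewrite ?orbT].
Qed.

(* Finitely many formulae up to equivalence are determined by [L]: they amount to
   boolean functions of the truth values of the formulae of [L]. *)
Definition determined L f := forall (B B' : set (seq S)) G G',
  (forall g, g \in L -> sat lab B G 0 g <-> sat lab B' G' 0 g) ->
  sat lab B G 0 f <-> sat lab B' G' 0 f.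

(** Progression decides literals and [Dollar], and what remains is a boolean combination of bodies
    of [Next] and of [Until] formulae, all of them subformulae of [f]. *)
Lemma progress_determined L b s f :
  {subset subformulas f <= L} -> determined L (progress lab b s f).
Proof.
move=> fL B B' G G' BB'.
have inL g : g \in L -> sat lab B G 0 g <-> sat lab B' G' 0 g by exact: BB'.
elim: f fL => [p|p||||f IHf g IHg|f IHf g IHg|f IHf|f IHf g IHg] fL /=; try by [|case: ifP].
- by rewrite IHf ?IHg // => h hf; apply: fL; rewrite in_cons mem_cat hf ?orbT.
- by rewrite IHf ?IHg // => h hf; apply: fL; rewrite in_cons mem_cat hf ?orbT.
- by apply: BB'; apply: fL; rewrite in_cons mem_subformulas orbT.
- have := BB' _ (fL _ (mem_subformulas (Until f g))) => /= ->.
  by rewrite IHf ?IHg // => h hf; apply: fL; rewrite in_cons mem_cat hf ?orbT.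
Qed.

(** Prefixing [s] turns the progressed formula back into [f], which depends on the members of [L] at
    [s]. Their values there are those of their own progressions, again determined by [L] by closure
    under subformulae. *)
Lemma prog_determined L b s f :
  (forall g, g \in L -> {subset subformulas g <= L}) ->
  determined L f -> determined L (prog lab b s f).
Proof.
move=> Lsub fL B B' G G' BB'; rewrite !sat_prog_scons; apply: fL => g gL.
rewrite -!sat_prog_scons !sat_simp.
exact: progress_determined (Lsub _ gL) _ _ _ _ BB'.
Qed.

Definition truth_values L (B : set (seq S)) G : (size L).-tuple bool :=
  [tuple of [seq `[< sat lab B G 0 g >] | g <- in_tuple L]].

(** Valuations realised by no model are sent to [false]. *)
Definition truth_table L f : {ffun (size L).-tuple bool -> bool} :=
  [ffun v => `[< exists B G, truth_values L B G = v /\ sat lab B G 0 f >]].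

Lemma truth_table_behaviour L f g : determined L f -> determined L g ->
  truth_table L f = truth_table L g -> behaviour lab f = behaviour lab g.
Proof.
move=> fL gL fg; suff sat_fg B G : sat lab B G 0 f <-> sat lab B G 0 g.
  rewrite /behaviour; congr bigcap; apply/seteqP.
  by split=> B Bv G; apply/sat_fg.
wlog suff sub : f g fL gL fg / sat lab B G 0 f -> sat lab B G 0 g.
  by split; apply: sub.
move=> fG; move/ffunP/(_ (truth_values L B G)): fg; rewrite !ffunE.
rewrite (_ : `[< _ >] = true); last by apply/asboolP; exists B, G.
(* The table only provides some model of [g] with the same values on [L]; [determined] transfers
   satisfaction to the given one. *)
move=> /esym/asboolP[B' [G' [/(congr1 val) /= BG gG']]].
have BB' h : h \in L -> sat lab B' G' 0 h <-> sat lab B G 0 h.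
  move=> hL; move/eq_in_map: BG => /(_ _ hL)/(congr1 is_true).
  by rewrite !asboolE => ->.
exact: (gL _ _ _ _ BB').1.
Qed.

End Finiteness.

(** * Correctness of the syntactic reward test *)

Section Rewards.
Variables (P : Type) (S : choiceType) (lab : S -> pred P).

Fixpoint dprogn (G : nat -> S) (f : fltl P) (n : nat) : fltl P :=
  if n is m.+1 then dprog lab (G m) (dprogn G f m) else f.

Lemma rew_behaviour (G : nat -> S) (f : fltl P) :
  reward_normal lab f -> (forall n, dprogn G f n <> Bot) ->
  rew lab (G 0) f <-> behaviour lab f [:: G 0].
Proof.
move=> fN fnBot; pose b n := rew lab (G n) (dprogn G f n).
split=> [/eqP fBot|f0].
  apply/not_notP => nf0.
  (* By reward normality this is the least set making [f] true along [G]. If it lacks [[:: G 0]],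
     progression with [false] yields a satisfied formula, which cannot be [Bot]. *)
  pose B := [set D | behaviour lab f D /\ pre G D].
  suff: sat lab B G 1 (prog lab false (G 0) f) by rewrite fBot.
  apply/sat_simp/sat_progress; first by split=> // -[].
  by apply/fN.
have prognE i n : progn lab G b i n (dprogn G f i) = dprogn G f (i + n).
  by elim: n i => [|n IHn] i; rewrite ?addn0 // -addSnnS -IHn.
(* These are the prefixes at which [rew] pays, so progression relative to [B] follows [dprogn]. As
   [Bot] never appears, [f] holds for [B], and reward normality puts [[:: G 0]] in [B]. *)
pose B := [set D | exists2 n, b n & D = mkseq G n.+1].
have bB n : b n <-> B (mkseq G n.+1).
  split=> [bn|[m bm /(congr1 size)]]; first by exists n.
  by rewrite !size_mkseq => -[->].
have : sat lab B G 0 f.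
  apply/not_notP => /(unsat_falsified bB) [N /(_ N (leqnn _))].
  by rewrite (prognE 0%N); apply: fnBot.
by move/fN => /(_ [:: G 0]) fB; apply/(bB 0%N)/fB; split=> //; exists 1%N.
Qed.

End Rewards.

(** * Built specifications and the histories leading to them *)

Section Built.
Variables (R : realType) (A : finType) (P : Type) (S : choiceType).
Variables (lab : S -> pred P) (D : nmrdp R S A) (phi0 : spec R P).
Hypothesis D_stochastic : stochastic D.
Hypothesis D_live : no_dead_end D.
Hypothesis phi0_R : spec_represents lab phi0 (nmrdp_reward D).
Hypothesis phi0_normal : spec_reward_normal lab phi0.
Hypothesis no_bot : no_bot_built lab D phi0.

Local Notation built := (built lab D phi0).
Implicit Types (s : S) (phi : spec R P).

Definition follows s s' := exists2 a, a \in appl D s & 0 < prob D s a s'.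

Lemma feasible_rcons s0 h s s' :
  feasible D s0 (FinSeq (rcons h s)) -> follows s s' ->
  feasible D s0 (FinSeq (rcons (rcons h s) s')).
Proof.
move=> [h0 hstep] ss'; split.
  by case: h h0 {hstep}.
rewrite -[rcons (rcons h s) s']cats1 => i x y; rewrite /state_at !onth_cat.
have [it|] := ltnP i.+1 (size (rcons h s)); first by
  rewrite (ltnW it); apply: hstep.
rewrite size_rcons ltnS leq_eqVlt => /predU1P[<-|hi].
  by rewrite ltnSn subnn -cats1 onth_cat ltnn subnn => -[<-] [<-].
by rewrite ltnNge hi /= subSn // => _; case: (i - _)%N.
Qed.

Lemma live_follows s : (exists a, a \in appl D s) -> exists s', follows s s'.
Proof.
move=> [a sa]; have [pos sum1] := D_stochastic sa.
apply/not_existsP => nfollow; move/eqP: sum1.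
rewrite fsbig1 ?(eq_sym 0) ?oner_eq0 // => s' _.
apply/eqP; rewrite eq_le pos andbT leNgt; apply/negP => ps'.
by apply: (nfollow s'); exists a.
Qed.

Lemma built_feasible s phi : built s phi ->
  exists h, feasible D (start D) (FinSeq (rcons h s)).
Proof.
elim=> [|{}s {}phi a s' _ [h hs] sa ss']; first by exists [::]; split=> // -[|i].
by exists (rcons h s); apply: feasible_rcons => //; exists a.
Qed.

Lemma built_live s phi : built s phi -> exists s', follows s s'.
Proof.
move=> /built_feasible[h hs]; apply: live_follows.
apply: (D_live (i := size h) hs).
by rewrite /= -cats1 onth_cat ltnn subnn.
Qed.

(** Obtained by iterating a chosen successor. The type [T] records that the states are built, since
    liveness is only assumed of reachable states. *)
Lemma built_path s phi : built s phi ->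
  exists2 G : nat -> S, G 0%N = s & forall n, follows (G n) (G n.+1).
Proof.
move=> bs; pose T := {x : S | exists psi, built x psi}.
have next (x : T) : {y : T | follows (sval x) (sval y)}.
  apply: cid; case: x => x [psi bx] /=; have [y [a xa xy]] := built_live bx.
  have by_ : exists psi', built y psi'.
    by exists (sprog lab x psi); apply: built_succ bx xa xy.
  by exists (exist _ y by_); exists a.
pose x0 : T := exist _ s (ex_intro _ phi bs).
exists (fun n => sval (iter n (fun x => sval (next x)) x0)) => // n.
by rewrite iterS; case: (next _).
Qed.

(** Along an infinite path from [s] the formulae of [dprogn] stay members of built specifications,
    so [no_bot] gives the hypothesis of [rew_behaviour]. *)
Lemma built_rew s phi fr : built s phi -> fr \in phi ->
  reward_normal lab fr.1 -> rew lab s fr.1 <-> behaviour lab fr.1 [:: s].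
Proof.
move=> bs frphi fN; have [G Gs Gf] := built_path bs; rewrite -Gs.
apply: rew_behaviour => // n fnBot.
have [psi [bpsi frpsi]] :
    exists psi, built (G n) psi /\ (dprogn lab G fr.1 n, fr.2) \in psi.
  elim: n {fnBot} => [|n [psi [bpsi frpsi]]].
    by exists phi; rewrite Gs -surjective_pairing.
  have [a Ga GG] := Gf n; exists (sprog lab (G n) psi).
  by split; [exact: built_succ bpsi Ga GG|exact: (map_f _ frpsi)].
by move/negP: (no_bot bpsi fr.2); rewrite -fnBot.
Qed.

Lemma sprog_normal s phi : built s phi -> spec_reward_normal lab phi ->
  spec_reward_normal lab (sprog lab s phi).
Proof.
move=> bs phiN _ /mapP[fr frphi ->].
exact: (prog_normal (phiN _ frphi) (built_rew bs frphi (phiN _ frphi))).1.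
Qed.

Lemma sprog_reward s phi E : built s phi -> spec_reward_normal lab phi ->
  E <> [::] -> spec_reward lab (sprog lab s phi) E = spec_reward lab phi (s :: E).
Proof.
move=> bs phiN E0; rewrite /spec_reward big_map /= big_seq_cond [RHS]big_seq_cond.
apply: eq_bigl => fr; have [frphi /=|//] := boolP (fr \in phi).
apply/idP/idP; rewrite !inE;
  by apply (prog_normal (phiN _ frphi) (built_rew bs frphi (phiN _ frphi))).2.
Qed.

Lemma immediate_rewardE s phi : built s phi -> spec_reward_normal lab phi ->
  immediate_reward lab s phi = spec_reward lab phi [:: s].
Proof.
move=> bs phiN; rewrite /immediate_reward /spec_reward big_seq_cond [RHS]big_seq_cond.
apply: eq_bigl => fr; have [frphi /=|//] := boolP (fr \in phi).
have rewP := built_rew bs frphi (phiN _ frphi).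
by apply/idP/idP => [/rewP|]; rewrite inE // => /rewP.
Qed.

Lemma built_normal s phi : built s phi -> spec_reward_normal lab phi.
Proof. by elim=> // {}s {}phi a s' bs phiN sa ss'; apply: sprog_normal. Qed.

(** The invariant of the construction: each progression moves one more state into the history
    [h]. *)
Lemma built_history s phi : built s phi ->
  exists2 h, feasible D (start D) (FinSeq (rcons h s)) &
    forall E, E <> [::] -> spec_reward lab phi E = nmrdp_reward D (h ++ E).
Proof.
elim=> [|{}s {}phi a s' bs [h hs hE] sa ss'].
  by exists [::]; [split=> // -[|i]|exact: phi0_R].
exists (rcons h s); first by apply: feasible_rcons => //; exists a.
by move=> E E0; rewrite sprog_reward ?hE ?cat_rcons //; exact: built_normal bs.
Qed.

(** * E-states as pairs of a state and a reward function *)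

Local Notation estate := (estate lab D phi0).
Local Notation D' := (translation lab D phi0).
Implicit Types (C : estate) (E : seq S).

Definition state_of C : S := (erepr C).1.
(** Equality of e-states fixes these values on sequences starting with [state_of C]; elsewhere they
    may depend on the representative. *)
Definition reward_of C E : R := spec_reward lab (erepr C).2 E.

(** The immediate reward is the value at [[:: s]], and the progressed specification gives the values
    at longer sequences starting with [s]. *)
Lemma estate_eqP s phi t psi : built s phi -> built t psi ->
  estate_eq lab (s, phi) (t, psi) <->
  s = t /\ forall E, spec_reward lab phi (s :: E) = spec_reward lab psi (s :: E).
Proof.
move=> bs bt; have [phiN psiN] := (built_normal bs, built_normal bt).
split=> [[/= st]|[st eqR]].
  rewrite -st in bt psiN *; rewrite !immediate_rewardE // => eq1 eqS; split=> //.
  case=> // x E; have := eqS (x :: E); rewrite !sprog_reward //; exact.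
rewrite -st in bt psiN *; split=> //=; first by rewrite !immediate_rewardE.
by move=> E E0; rewrite !sprog_reward.
Qed.

Lemma erepr_in C : val C (erepr C).
Proof.
apply: xgetPex; case: C => C /= /set_mem[e be ->]; exists e.
by split=> //; split.
Qed.

Lemma estate_val C : exists2 e, built e.1 e.2 & val C = eclass lab D phi0 e.
Proof. by case: C => C /= /set_mem. Qed.

Lemma erepr_built C : built (state_of C) (erepr C).2.
Proof. by have [e be CE] := estate_val C; have := erepr_in C; rewrite CE => -[]. Qed.

Lemma in_estate C s phi : val C (s, phi) <->
  [/\ built s phi, s = state_of C &
      forall E, spec_reward lab phi (s :: E) = reward_of C (s :: E)].
Proof.
have [[t psi] /= bt CE] := estate_val C; have := erepr_in C; have := erepr_built C.
rewrite /state_of /reward_of; case: (erepr C) => t' psi' /= bt'.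
rewrite CE => -[/= _ /(estate_eqP bt bt')[tt' eqC]]; rewrite -tt' in bt' *.
split=> [[/= bs /(estate_eqP bt bs)[ts eqs]]|[bs st eqs]].
  by rewrite -ts in bs *; split=> // E; rewrite -eqs eqC.
rewrite st in bs eqs *; split=> //=; apply/estate_eqP => //.
by split=> // E; rewrite eqC eqs.
Qed.

Lemma estate_inj C C' : state_of C = state_of C' ->
  (forall E, reward_of C (state_of C :: E) = reward_of C' (state_of C :: E)) ->
  C = C'.
Proof.
move=> sE rE; apply/val_inj/seteqP.
split=> -[s phi] /in_estate[bs sC rC]; apply/in_estate; split=> //.
- by rewrite sC.
- by move=> E; rewrite rC sC rE.
- by rewrite sC.
- by move=> E; rewrite rC sC -sE rE.
Qed.

Lemma built_estate s phi : built s phi -> exists C, val C (s, phi).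
Proof.
move=> bs; have inC : eclass lab D phi0 (s, phi) \in estates lab D phi0.
  by rewrite inE; exists (s, phi).
by exists (exist (fun X => X \in estates lab D phi0) _ inC); split=> //; split.
Qed.

Definition estep C C' : Prop :=
  exists2 phi, val C (state_of C, phi) &
    val C' (state_of C', sprog lab (state_of C) phi).

Lemma prob_translation C a C' : prob D' C a C' =
  if `[< estep C C' >] then prob D (state_of C) a (state_of C') else 0.
Proof. by []. Qed.

Lemma reward_translation C : mdp_reward D' C = reward_of C [:: state_of C].
Proof.
by rewrite /= immediate_rewardE //; [|apply: built_normal]; exact: erepr_built.
Qed.

Lemma estep_reward C C' E : estep C C' ->
  reward_of C' (state_of C' :: E) = reward_of C [:: state_of C, state_of C' & E].
Proof.
move=> [phi /in_estate[bC _ rC] /in_estate[bC' _ rC']].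
by rewrite -rC' sprog_reward ?rC //; exact: built_normal bC.
Qed.

(** The rewards of a successor are a derivative of those of [C], so its state alone determines
    it. *)
Lemma estep_inj C C1 C2 : estep C C1 -> estep C C2 ->
  state_of C1 = state_of C2 -> C1 = C2.
Proof.
move=> CC1 CC2 s12; apply: estate_inj => // E.
by rewrite (estep_reward E CC1) s12 (estep_reward E CC2).
Qed.

Lemma estep_ex C s' : follows (state_of C) s' ->
  exists2 C', state_of C' = s' & estep C C'.
Proof.
move=> [a Ca pos].
have [C' C'in] := built_estate (built_succ (erepr_built C) Ca pos).
have [_ sC' _] := (in_estate _ _ _).1 C'in; exists C' => //.
exists (erepr C).2; last by rewrite -sC'.
by rewrite /state_of -surjective_pairing; exact: erepr_in.
Qed.

Lemma translation_stochastic : stochastic D'.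
Proof.
move=> C a Ca; have [pos sum1] := D_stochastic Ca; split.
  by move=> C'; rewrite prob_translation; case: ifP.
rewrite -sum1 fsbig_supp [RHS]fsbig_supp.
set Q' := (X in \sum_(t \in X) _ = _); set Q := (X in _ = \sum_(t \in X) _).
have succ C' : Q' C' -> estep C C' /\ prob D (state_of C) a (state_of C') != 0.
  move=> [_ pC']; have : prob D' C a C' != 0 by apply/eqP.
  by rewrite prob_translation; case: asboolP; rewrite ?eqxx.
(* Between the supports [state_of] is a bijection: injective by [estep_inj], surjective by
   [estep_ex]. *)
rewrite (@reindex_fsbig _ _ _ _ _ state_of Q' Q); last first.
  split=> [C' /succ[_ /eqP]|C1 C2|s' [_ /= /eqP ps']].
  - by split.
  - by move=> /set_mem/succ[CC1 _] /set_mem/succ[CC2 _]; exact: estep_inj CC1 CC2.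
  - have [|C' C's' CC'] := @estep_ex C s'.
      by exists a => //; rewrite lt0r ps' pos.
    exists C' => //; split=> //; suff : prob D' C a C' != 0 by move/eqP.
    by rewrite prob_translation; case: asboolP; rewrite ?C's' //; apply/eqP.
apply: eq_fsbigr => C' /set_mem/succ[CC' _].
by rewrite prob_translation; case: ifP => // /asboolP.
Qed.

Lemma estep_feasible C (G' : pseq estate) i C1 C2 : feasible D' C G' ->
  state_at G' i = Some C1 -> state_at G' i.+1 = Some C2 -> estep C1 C2.
Proof.
move=> [_ step] /step{}step /step[a _]; rewrite prob_translation.
by case: ifP => [/asboolP|]; rewrite ?ltxx.
Qed.

Lemma feasible_reward C (G' : pseq estate) i C' E :
  feasible D' C G' -> state_at G' i = Some C' ->
  reward_of C' (state_of C' :: E) =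
  reward_of C (map state_of (first G' i) ++ state_of C' :: E).
Proof.
move=> CG'; elim: i C' E => [|i IHi] C' E iC'.
  move: CG' => [+ _]; rewrite iC' => -[->].
  by rewrite first0.
have [C1 iC1] := state_at_prev iC'.
rewrite (estep_reward _ (estep_feasible CG' iC1 iC')) IHi //.
by rewrite (state_at_first iC1) map_rcons cat_rcons.
Qed.

Lemma reward_feasible C (G' : pseq estate) i C' :
  feasible D' C G' -> state_at G' i = Some C' ->
  mdp_reward D' C' = reward_of C (map state_of (first G' i.+1)).
Proof.
move=> CG' iC'; rewrite reward_translation (feasible_reward _ CG' iC').
by rewrite (state_at_first iC') map_rcons cats1.
Qed.

Lemma start_in_start : val (start_estate lab D phi0) (start D, phi0).
Proof. by split; [exact: built_start|split]. Qed.

Lemma reward_of_start E :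
  reward_of (start_estate lab D phi0) (start D :: E) =
  nmrdp_reward D (start D :: E).
Proof. by have [_ _ <-] := (in_estate _ _ _).1 start_in_start; rewrite phi0_R. Qed.

Lemma state_of_start : state_of (start_estate lab D phi0) = start D.
Proof. by have [_ <-] := (in_estate _ _ _).1 start_in_start. Qed.

Lemma translation_succ C s' : follows (state_of C) s' ->
  exists! C', state_of C' = s' /\
    forall a, a \in appl D' C -> prob D' C a C' = prob D (state_of C) a s'.
Proof.
move=> Cs'; have [C' C's CC'] := estep_ex Cs'; rewrite -{s'}C's in Cs' *.
exists C'; split.
  by split=> // a _; rewrite prob_translation; case: asboolP.
move=> C2 [C2s C2p]; have [a Ca pos] := Cs'.
(* A rival successor receives a positive probability, not the default [0], hence is reached by
   [estep]. *)
move: (C2p a Ca) pos; rewrite prob_translation.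
case: asboolP => [CC2 _ _|_ <-]; last by rewrite ltxx.
by apply: estep_inj CC' CC2 _; rewrite C2s.
Qed.

(** The value [0] is the one blind minimality prescribes; it also hides the values of [reward_of]
    that depend on the representative. *)
Definition estate_reward C E : R :=
  if ohead E == Some (state_of C) then reward_of C E else 0.

Lemma represents_estate_reward : represents D' state_of estate_reward.
Proof.
split=> [C C' [sE rE]|C G' CG' i C' iC'].
  apply: estate_inj => // E; have := congr1 (@^~ (state_of C :: E)) rE.
  by rewrite /estate_reward /= -sE !eqxx.
rewrite (reward_feasible CG' iC') /estate_reward; have [C0 _] := CG'.
move: (ohead_first G' i); rewrite C0.
by case: (first G' i.+1) => //= ? ? [->]; rewrite eqxx.
Qed.

Lemma translation_blind_minimal : blind_minimal D D' state_of.
Proof.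
exists estate_reward; first exact: represents_estate_reward.
move=> C; have [h Ch hE] := built_history (erepr_built C).
(* The index [size h] is that of the last state, so the prefix strictly before it is exactly [h]. *)
exists (FinSeq (rcons h (state_of C))), (size h); split=> //.
  by rewrite /state_at -cats1 onth_cat ltnn subnn.
move=> [|x E] //=; rewrite /estate_reward /= -cats1 take_size_cat //.
by case: eqP => // _; rewrite /reward_of hE.
Qed.

Lemma translation_equivalent : finite_set [set: estate] ->
  equivalent_xmdp D D' state_of.
Proof.
move=> fin; split=> //.
- by split=> //; exact: translation_stochastic.
- exact: state_of_start.
- by move=> s1 s2 + C C1; rewrite -C1; exact: translation_succ.
- move=> G G' DG DG' GG' i C' iC'.
  rewrite (reward_feasible DG' iC') (map_first _ GG').
  have [G0 _] := DG; move: (ohead_first G i); rewrite G0.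
  by case: (first G i.+1) => //= ? ? [->]; rewrite reward_of_start.
Qed.

End Built.

(** * Finiteness of the set of e-states *)

Section Finite.
Variables (R : realType) (A : finType) (P : Type) (S : finType).
Variables (lab : S -> pred P) (D : nmrdp R S A) (phi0 : spec R P).

Hypothesis D_stochastic : stochastic D.
Hypothesis D_live : no_dead_end D.
Hypothesis phi0_normal : spec_reward_normal lab phi0.
Hypothesis no_bot : no_bot_built lab D phi0.

Let L := flatten [seq subformulas fr.1 | fr <- phi0].

Let subformulas_closed g : g \in L -> {subset subformulas g <= L}.
Proof.
move=> /flatten_mapP[fr frphi gfr] h hg; apply/flatten_mapP; exists fr => //.
exact: subformulas_trans gfr _ hg.
Qed.

Lemma spec_reward_truth_tables (phi psi : spec R P) E :
  (forall fr, fr \in phi -> determined lab L fr.1) ->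
  (forall fr, fr \in psi -> determined lab L fr.1) ->
  [seq fr.2 | fr <- phi] = [seq fr.2 | fr <- psi] ->
  [seq truth_table lab L fr.1 | fr <- phi] =
  [seq truth_table lab L fr.1 | fr <- psi] ->
  spec_reward lab phi E = spec_reward lab psi E.
Proof.
rewrite /spec_reward.
elim: phi psi => [|fr phi IH] [|gr psi] // fL gL [r12 rE] [t12 tE].
rewrite !big_cons r12 (@truth_table_behaviour _ _ _ L fr.1 gr.1) //.
- by rewrite (IH psi) // => x xin; [apply: fL|apply: gL]; rewrite in_cons xin orbT.
- by apply: fL; apply: mem_head.
- by apply: gL; apply: mem_head.
Qed.

(** Progression keeps the rewards and their order, so built specifications differ only in formulae
    determined by [L]. *)
Lemma built_determined s phi : built lab D phi0 s phi ->
  [seq fr.2 | fr <- phi] = [seq fr.2 | fr <- phi0] /\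
  forall fr, fr \in phi -> determined lab L fr.1.
Proof.
elim=> [|{}s {}phi a s' _ [rE fL] _ _]; split=> //.
- move=> fr frphi B B' G G'; apply; apply/flatten_mapP.
  by exists fr => //; apply: mem_subformulas.
- by rewrite -map_comp -rE.
- by move=> _ /mapP[fr /fL frL ->]; apply: prog_determined.
Qed.

(** An e-state is determined by its state and the truth tables of its formulae, and such keys range
    over a finite type. *)
Lemma finite_estates : finite_set [set: estate lab D phi0].
Proof.
pose tables (C : estate lab D phi0) :=
  [seq truth_table lab L fr.1 | fr <- (erepr C).2].
pose key C := ((erepr C).1,
  [ffun i : 'I_(size phi0) => nth [ffun=> false] (tables C) i]).
suff key_inj : {in [set: estate lab D phi0] &, injective key}.
  by rewrite -(eq_finite_set (inj_card_eq key_inj)); exact: finite_finset.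
move=> C C' _ _ [sE /ffunP kE].
have [rE1 L1] := built_determined (erepr_built C).
have [rE2 L2] := built_determined (erepr_built C').
(* Both lists have the length of [phi0], so the default of [nth] in [key] is never read and the keys
   recover the whole lists of tables. *)
have size1 : size (erepr C).2 = size phi0 by rewrite -!(size_map snd) rE1.
have size2 : size (erepr C').2 = size phi0 by rewrite -!(size_map snd) rE2.
have tE : tables C = tables C'.
  apply: (@eq_from_nth _ [ffun=> false]); rewrite !size_map size1 ?size2 // => i ip.
  by have := kE (Ordinal ip); rewrite !ffunE.
apply: estate_inj => // E; apply: spec_reward_truth_tables => //.
by rewrite rE1 rE2.
Qed.

End Finite.

Theorem theorem4 (R : realType) (P : Type) (S A : finType)
    (lab : S -> pred P) (D : nmrdp R S A) (phi0 : spec R P)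
    (lab_inj : injective lab)
    (D_stochastic : stochastic D)
    (D_live : no_dead_end D)
    (phi0_R : spec_represents lab phi0 (nmrdp_reward D))
    (phi0_normal : spec_reward_normal lab phi0)
    (no_bot : no_bot_built lab D phi0) :
  blind_minimal_equivalent_xmdp D (translation lab D phi0).
Proof.
exists (@state_of _ _ _ _ lab D phi0); last exact: translation_blind_minimal.
by apply: translation_equivalent => //; exact: finite_estates.
Qed.
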